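(* The incidence graphs of any two finite projective planes of the same order are $\mathrm W_{1/2}$-equivalent.
   Context: The incidence graph of a finite projective plane $\mathcal P$ is the (uncolored, undirected) bipartite graph whose vertices are the points and lines of $\mathcal P$ and whose edges join incident point–line pairs. **Rainbows and coherent configurations.** $\Omega$ is a finite set. For $\Delta\subseteq\Omega$ put $1_\Delta=\{(\delta,\delta):\delta\in\Delta\}$, $1_\delta=1_{\{\delta\}}$; for $s\subseteq\Omega^2$ put $s^*=\{(\alpha,\beta):(\beta,\alpha)\in s\}$ and $\alpha s=\{\beta:(\alpha,\beta)\in s\}$. A rainbow on $\Omega$ is a pair $\mathcal X=(\Omega,S)$ with $S$ a partition of $\Omega^2$ such that $1_\Omega$ is a union of classes of $S$ and $s^*\in S$ for all $s\in S$. Elements of $S=S(\mathcal X)$ are basis relations; $S^\cup$ is the set of all unions of them. A fiber is a set $\Delta\subseteq\Omega$ with $1_\Delta\in S$; $F(\mathcal X)$ is the set of fibers. $\mathcal X$ is a coherent configuration if for all $r,s,t\in S$ the number $c_{r,s}^t=|\alpha r\cap\beta s^*|$ does not depend on $(\alpha,\beta)\in t$. Write $\mathcal X\le\mathcal Y$ if $S(\mathcal X)^\cup\subseteq S(\mathcal Y)^\cup$; the intersection of rainbows on $\Omega$ is defined by $S(\mathcal X\cap\mathcal Y)^\cup=S(\mathcal X)^\cup\cap S(\mathcal Y)^\cup$. For a coherent configuration $\mathcal X$ and $\alpha\in\Omega$, $\mathcal X_\alpha$ is the smallest coherent configuration $\mathcal Y\ge\mathcal X$ with $1_\alpha\in S(\mathcal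 Y)^\cup$. **Algebraic isomorphisms.** An algebraic isomorphism $\varphi:\mathcal X\to\mathcal X'$ of coherent configurations is a bijection $S\to S'$ preserving all intersection numbers; it extends naturally to $S^\cup$ and to fibers ($\Delta\mapsto\Delta^\varphi$). For $\alpha\in\Omega,\alpha'\in\Omega'$ the $\alpha\alpha'$-extension of $\varphi$ is an algebraic isomorphism $\mathcal X_\alpha\to\mathcal X'_{\alpha'}$ agreeing with $\varphi$ on $S(\mathcal X)$ and taking $1_\alpha$ to $1_{\alpha'}$. $\varphi$ is sesquiclosed if it has the $\alpha\alpha'$-extension for all $\alpha\in\Delta\in F(\mathcal X)$, $\alpha'\in\Delta'\in F(\mathcal X')$ with $\Delta^\varphi=\Delta'$. **Sesquiclosure.** A coherent configuration $\mathcal X$ is sesquiclosed if for all $\alpha,\alpha'\in\Omega$: (S1) $F(\mathcal X_\alpha)=\{\alpha s: s\in S,\ \alpha s\ne\varnothing\}$; (S2) if $\alpha,\alpha'$ lie in the same fiber, then $\mathrm{id}_{\mathcal X}$ has the $\alpha\alpha'$-extension. For a rainbow $\mathcal X$, $\mathrm W_{1/2}(\mathcal X)$ is the intersection of all sesquiclosed coherent configurations $\mathcal Y\ge\mathcal X$ (it is sesquiclosed). **$\mathrm W_{1/2}$-equivalence of graphs.** A graph $\mathcal G$ with vertex set $\Omega$ and edge set $E$ (a symmetric relation) is treated as the rainbow $\mathcal X(\mathcal G)$ with basis relations $1_\Omega$, $E$, and the edge set of the complement. Graphs $\mathcal G,\mathcal G'$ are $\mathrm W_{1/2}$-equivalent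 if there is a sesquiclosed algebraic isomorphism $\psi:\mathrm W_{1/2}(\mathcal X(\mathcal G))\to\mathrm W_{1/2}(\mathcal X(\mathcal G'))$ extending the standard similarity, i.e., taking $1_\Omega$ to $1_{\Omega'}$, edges to edges, and the complement's edges to the complement's edges. *)

(* Defs.v *)
From mathcomp Require Import all_boot.
From mathcomp Require Import boolp.

Set Implicit Arguments.
Unset Strict Implicit.
Unset Printing Implicit Defensive.

(* A rainbow on T is represented by its set S of basis relations. *)

Section Rainbows.

Variable T : finType.
Implicit Types (r s t : {set T * T}) (S X Y : {set {set T * T}}).
Implicit Types (D : {set T}) (a b : T) (P : {set {set T * T}} -> Prop).

Definition diag D : {set T * T} := [set (x, x) | x in D].

Definition converse s : {set T * T} := [set u | (u.2, u.1) \in s].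

Definition out_nbrs a s : {set T} := [set b | (a, b) \in s].

Definition unions S : {set {set T * T}} :=
  [set cover A | A : {set {set T * T}} in powerset S].

Definition rainbow S : Prop :=
  [/\ partition S [set: T * T],
      diag [set: T] \in unions S
    & forall s, s \in S -> converse s \in S].

Definition fibers S : {set {set T}} := [set D | diag D \in S].

(* |alpha r n beta s^*| for u = (alpha, beta); when S is coherent and u runs
   over t in S, this is the intersection number c_{r,s}^t. *)
Definition inter_num r s (u : T * T) : nat :=
  #|out_nbrs u.1 r :&: out_nbrs u.2 (converse s)|.

Definition coherent S : Prop :=
  rainbow S /\
  forall r s t, r \in S -> s \in S -> t \in S ->
  forall u v, u \in t -> v \in t -> inter_num r s u = inter_num r s v.

Definition rainbow_le X Y : Prop := unions X \subset unions Y.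

(* The intersection of all rainbows satisfying P: its unions are the relations
   that lie in unions Y for all such Y (see unions_rainbow_cap), so its basis
   relations are the minimal nonempty relations of this kind. *)
Definition common_unions P : {set {set T * T}} :=
  [set r | `[< forall Y, P Y -> r \in unions Y >]].

Definition rainbow_cap P : {set {set T * T}} :=
  [set s | minset [pred r | (r \in common_unions P) && (r != set0)] s].

(* X_alpha; see point_ext_smallest. *)
Definition point_ext X a : {set {set T * T}} :=
  rainbow_cap (fun Y => [/\ coherent Y, rainbow_le X Y
                          & diag [set a] \in unions Y]).

End Rainbows.

(* An algebraic isomorphism is given by a function on all relations, of which
   only the values on S matter. *)
Definition alg_iso (T T' : finType)
    (S : {set {set T * T}}) (S' : {set {set T' * T'}})
    (phi : {set T * T} -> {set T' * T'}) : Prop :=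
  [/\ coherent S, coherent S',
      {in S &, injective phi}, phi @: S = S'
    & forall r s t, r \in S -> s \in S -> t \in S ->
      forall u u', u \in t -> u' \in phi t ->
      inter_num r s u = inter_num (phi r) (phi s) u'].

(* The extension of phi from S to unions of elements of S. *)
Definition ext_unions (T T' : finType) (S : {set {set T * T}})
    (phi : {set T * T} -> {set T' * T'}) (r : {set T * T}) : {set T' * T'} :=
  \bigcup_(s in S | s \subset r) phi s.

Definition has_point_extension (T T' : finType)
    (S : {set {set T * T}}) (S' : {set {set T' * T'}})
    (phi : {set T * T} -> {set T' * T'}) (a : T) (a' : T') : Prop :=
  exists psi : {set T * T} -> {set T' * T'},
    [/\ alg_iso (point_ext S a) (point_ext S' a') psi,
        forall s, s \in S -> ext_unions (point_ext S a) psi s = phi s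
      & ext_unions (point_ext S a) psi (diag [set a]) = diag [set a']].

(* phi maps the fiber D to D' when it maps 1_D to 1_D'. *)
Definition sesquiclosed_iso (T T' : finType)
    (S : {set {set T * T}}) (S' : {set {set T' * T'}})
    (phi : {set T * T} -> {set T' * T'}) : Prop :=
  alg_iso S S' phi /\
  forall D D', D \in fibers S -> D' \in fibers S' -> phi (diag D) = diag D' ->
  forall a a', a \in D -> a' \in D' -> has_point_extension S S' phi a a'.

Definition sesquiclosed (T : finType) (S : {set {set T * T}}) : Prop :=
  [/\ coherent S,
      forall a, fibers (point_ext S a) =
                [set out_nbrs a s | s in S & out_nbrs a s != set0]
    & forall D, D \in fibers S -> forall a a', a \in D -> a' \in D ->
      has_point_extension S S id a a'].

Definition W_half (T : finType) (X : {set {set T * T}}) : {set {set T * T}} :=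
  rainbow_cap (fun Y => sesquiclosed Y /\ rainbow_le X Y).

Section Graphs.

Variables (T : finType) (e : rel T).

Definition edge_set : {set T * T} := [set u | e u.1 u.2].

Definition nonedge_set : {set T * T} :=
  [set u | (u.1 != u.2) && ~~ e u.1 u.2].

(* For complete or edgeless graphs some of the three relations are empty. *)
Definition graph_rainbow : {set {set T * T}} :=
  [set diag [set: T]; edge_set; nonedge_set] :\ set0.

End Graphs.

Definition W_half_equiv (T T' : finType) (e : rel T) (e' : rel T') : Prop :=
  let W := W_half (graph_rainbow e) in
  let W' := W_half (graph_rainbow e') in
  exists psi : {set T * T} -> {set T' * T'},
    [/\ sesquiclosed_iso W W' psi,
        ext_unions W psi (diag [set: T]) = diag [set: T'],
        ext_unions W psi (edge_set e) = edge_set e'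
      & ext_unions W psi (nonedge_set e) = nonedge_set e'].

Record projective_plane := ProjectivePlane {
  point : finType;
  line : finType;
  incident : point -> line -> bool;
  plane_join : forall p q, p != q ->
    exists! l, incident p l /\ incident q l;
  plane_meet : forall l m, l != m ->
    exists! p, incident p l /\ incident p m;
  plane_quadrangle : exists Q : {set point},
    #|Q| = 4 /\ forall l, #|[set p in Q | incident p l]| <= 2
}.

Definition has_order (P : projective_plane) (n : nat) : Prop :=
  forall l : line P, #|[set p : point P | incident p l]| = n.+1.

Definition incidence_graph (P : projective_plane) : rel (point P + line P) :=
  fun u v => match u, v with
             | inl p, inr l => incident p l
             | inr l, inl p => incident p l
             | _, _ => false
             end.

(* Adequacy of the encoding of intersections and of point extensions. *)

Section Adequacy.

Variable T : finType.
Implicit Types (r s t : {set T * T}) (S X Y : {set {set T * T}}).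
Implicit Types (a : T) (P : {set {set T * T}} -> Prop).

Lemma unionsP S r : partition S [set: T * T] ->
  reflect (forall s u v, s \in S -> u \in s -> v \in s -> u \in r -> v \in r)
          (r \in unions S).
Proof.
case/and3P=> /eqP Scov Striv _; apply: (iffP imsetP) => [[A]|Sr].
  rewrite powersetE => /subsetP sAS -> s u v Ss su sv /bigcupP[t At tu].
  apply/bigcupP; exists s => //.
  by rewrite -(def_pblock Striv Ss su) (def_pblock Striv (sAS _ At) tu).
exists [set s in S | s \subset r].
  by rewrite powersetE; apply/subsetP => s /[!inE] /andP[].
apply/setP => u; apply/idP/bigcupP => [ru|[s]]; last first.
  by rewrite inE => /andP[_ /subsetP]; apply.
have : u \in cover S by rewrite Scov.
case/bigcupP=> s Ss su; exists s => //; rewrite inE Ss.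
by apply/subsetP => v sv; apply: (Sr s u v).
Qed.

Lemma sub_unions S s : s \in S -> s \in unions S.
Proof.
move=> Ss; apply/imsetP; exists [set s]; first by rewrite powersetE sub1set.
by rewrite /cover big_set1.
Qed.

Lemma common_unionsP P r :
  reflect (forall Y, P Y -> r \in unions Y) (r \in common_unions P).
Proof. by rewrite inE; apply: asboolP. Qed.

Section Cap.

Variable P : {set {set T * T}} -> Prop.
Hypothesis Prainbow : forall Y, P Y -> rainbow Y.

Let partP Y : P Y -> partition Y [set: T * T].
Proof. by move=> /Prainbow[]. Qed.

Lemma common_unionsC r : r \in common_unions P -> ~: r \in common_unions P.
Proof.
move=> /common_unionsP Pr; apply/common_unionsP => Y PY.
apply/unionsP; [exact: partP|move=> s u v Ys su sv]; rewrite !inE.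
by apply: contra; move/unionsP: (Pr Y PY) => /(_ (partP PY))/(_ s v u); apply.
Qed.

Lemma common_unionsI r s : r \in common_unions P -> s \in common_unions P ->
  r :&: s \in common_unions P.
Proof.
move=> /common_unionsP Pr /common_unionsP Ps; apply/common_unionsP => Y PY.
apply/unionsP; [exact: partP|move=> t u v Yt tu tv]; rewrite !inE.
move=> /andP[ru su]; apply/andP; split.
  by move/unionsP: (Pr Y PY) => /(_ (partP PY))/(_ t u v); apply.
by move/unionsP: (Ps Y PY) => /(_ (partP PY))/(_ t u v); apply.
Qed.

Lemma rainbow_cap_sub s r u : s \in rainbow_cap P -> r \in common_unions P ->
  u \in s -> u \in r -> s \subset r.
Proof.
rewrite [s \in _]inE => /minsetP[/andP[Ps _] smin] Pr su ru.
suff <- : s :&: r = s by apply: subsetIr.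
apply: smin; last exact: subsetIl.
by rewrite /= common_unionsI //; apply/set0Pn; exists u; rewrite inE su.
Qed.

Lemma rainbow_cap_ex u : exists2 s, s \in rainbow_cap P & u \in s.
Proof.
have Pu : [set: T * T] \in common_unions P.
  by apply/common_unionsP => Y PY; apply/unionsP; [exact: partP|move=> *; rewrite inE].
have [s /minsetP[/andP[Ps su] smin] _] :=
  @minset_exists _ [pred r | (r \in common_unions P) && (u \in r)] _
    (introT andP (conj Pu (in_setT u))).
exists s => //; rewrite inE; apply/minsetP; split.
  by rewrite /= Ps; apply/set0Pn; exists u.
move=> r /andP[/= Pr r0] srs; have [ru|ru] := boolP (u \in r).
  by apply: smin => //=; rewrite Pr.
have : s :&: ~: r = s.
  apply: smin; last exact: subsetIl.
  by rewrite /= common_unionsI ?common_unionsC // in_setI in_setC su.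
move=> /setIidPl /subsetP sr; case/set0Pn: r0 => v rv.
by have := sr v (subsetP srs v rv); rewrite inE rv.
Qed.

Lemma rainbow_cap_partition : partition (rainbow_cap P) [set: T * T].
Proof.
apply/and3P; split.
- apply/eqP/setP => u; rewrite inE; apply/bigcupP.
  by have [s] := rainbow_cap_ex u; exists s.
- apply/trivIsetP => s t Cs Ct; apply: contraR => /pred0Pn[u /andP[/= su tu]].
  have cU r : r \in rainbow_cap P -> r \in common_unions P.
    by rewrite [r \in rainbow_cap P]inE => /minsetP[/andP[]].
  by rewrite eqEsubset (rainbow_cap_sub Cs (cU t Ct) su tu)
             (rainbow_cap_sub Ct (cU s Cs) tu su).
- by rewrite inE; apply/negP => /minsetP[/andP[_ /eqP]].
Qed.

Lemma unions_rainbow_cap : unions (rainbow_cap P) = common_unions P.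
Proof.
apply/setP => r; apply/idP/idP => [/unionsP|Pr]; last first.
  apply/unionsP; first exact: rainbow_cap_partition.
  by move=> s u v Cs su sv ru; apply: (subsetP (rainbow_cap_sub Cs Pr su ru)).
move=> /(_ rainbow_cap_partition) Cr; apply/common_unionsP => Y PY.
apply/unionsP; [exact: partP|move=> t u v Yt tu tv ru].
have [s Cs su] := rainbow_cap_ex u; apply: (Cr s u v) => //.
move: Cs; rewrite inE => /minsetP[/andP[/common_unionsP Ps _] _].
by move/unionsP: (Ps Y PY) => /(_ (partP PY))/(_ t u v); apply.
Qed.

Lemma rainbow_cap_rainbow : rainbow (rainbow_cap P).
Proof.
have convU r : r \in common_unions P -> converse r \in common_unions P.
  move=> /common_unionsP Pr; apply/common_unionsP => Y PY.
  apply/unionsP; [exact: partP|move=> t u v Yt tu tv]; rewrite !inE.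
  have [_ _ /(_ t Yt) Yt'] := Prainbow PY.
  move/unionsP: (Pr Y PY) => /(_ (partP PY))/(_ _ (u.2, u.1) (v.2, v.1) Yt').
  by apply; rewrite inE -surjective_pairing.
have convK r : converse (converse r) = r.
  by apply/setP => -[x y]; rewrite !inE.
split; first exact: rainbow_cap_partition.
  by rewrite unions_rainbow_cap; apply/common_unionsP => Y /Prainbow[].
move=> s; rewrite !inE => /minsetP[/andP[/= Ps s0] smin].
apply/minsetP; split.
  rewrite /= convU //; case/set0Pn: s0 => -[x y] sxy.
  by apply/set0Pn; exists (y, x); rewrite inE.
move=> r /andP[/= Pr r0] /subsetP rs; rewrite -[r]convK; congr converse.
apply: smin.
  rewrite /= convU //; case/set0Pn: r0 => -[x y] rxy.
  by apply/set0Pn; exists (y, x); rewrite inE.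
by apply/subsetP => -[x y]; rewrite inE => /rs; rewrite inE.
Qed.

End Cap.

Lemma coherent_unions S r s : coherent S -> r \in unions S -> s \in unions S ->
  forall t u v, t \in S -> u \in t -> v \in t ->
  inter_num r s u = inter_num r s v.
Proof.
move=> [[Spart _ _] Scoh] Sr Ss t u v St tu tv.
have Striv : trivIset S by case/and3P: Spart.
have pbS x : pblock S x \in S.
  by apply: pblock_mem; case/and3P: Spart => /eqP -> _ _; rewrite inE.
have xpb x : x \in pblock S x.
  by rewrite mem_pblock; case/and3P: Spart => /eqP -> _ _; rewrite inE.
have inU q x : q \in unions S -> (x \in q) = (pblock S x \subset q).
  move=> /(unionsP _ Spart) Sq; apply/idP/subsetP => [qx y|]; last exact.
  by move=> xy; apply: (Sq (pblock S x) x y).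
suff E x : inter_num r s x = \sum_(p in setX S S | (p.1 \subset r) && (p.2 \subset s))
    inter_num p.1 p.2 x.
  rewrite !E; apply: eq_bigr => p; rewrite inE => /andP[/andP[Sp1 Sp2] _].
  exact: (Scoh _ _ t).
rewrite /inter_num -sum1_card.
pose f z := (pblock S (x.1, z), pblock S (z, x.2)).
rewrite (partition_big f
  (fun p => (p \in setX S S) && ((p.1 \subset r) && (p.2 \subset s)))) /=.
  apply: eq_bigr => -[p1 p2]; rewrite !inE /= => /andP[/andP[Sp1 Sp2] /andP[p1r p2s]].
  rewrite -sum1_card; apply: eq_bigl => z; rewrite !inE /f xpair_eqE /=.
  apply/idP/idP => [/andP[_ /andP[/eqP <- /eqP <-]]|/andP[zp1 zp2]].
    by rewrite !xpb.
  by rewrite (subsetP p1r) ?(subsetP p2s) //= (def_pblock Striv Sp1 zp1)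
             (def_pblock Striv Sp2 zp2) !eqxx.
by move=> z; rewrite !inE /= => /andP[rz sz]; rewrite !pbS -!inU ?rz.
Qed.

Lemma rainbow_cap_coherent P :
  (forall Y, P Y -> coherent Y) -> coherent (rainbow_cap P).
Proof.
move=> Pcoh; have Prb Y : P Y -> rainbow Y by move=> /Pcoh[].
split; first exact: rainbow_cap_rainbow.
move=> r s t Cr Cs Ct u v tu tv.
have cU q : q \in rainbow_cap P -> q \in common_unions P.
  by rewrite [q \in rainbow_cap P]inE => /minsetP[/andP[]].
pose N := [set x | inter_num r s x == inter_num r s u].
suff PN : N \in common_unions P.
  have := subsetP (rainbow_cap_sub Prb Ct PN tu _) v tv.
  by rewrite !inE eqxx => /(_ isT)/eqP.
apply/common_unionsP => Y PY; apply/unionsP; first by case: (Prb Y PY).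
move=> q x y Yq qx qy; rewrite !inE => /eqP <-; apply/eqP.
have cY w : w \in rainbow_cap P -> w \in unions Y.
  by move=> /cU /common_unionsP; apply.
exact: (coherent_unions (Pcoh Y PY) (cY r Cr) (cY s Cs) Yq).
Qed.

Lemma point_ext_smallest X a :
  [/\ coherent (point_ext X a), rainbow_le X (point_ext X a),
      diag [set a] \in unions (point_ext X a)
    & forall Y, coherent Y -> rainbow_le X Y -> diag [set a] \in unions Y ->
      rainbow_le (point_ext X a) Y].
Proof.
pose P Y := [/\ coherent Y, rainbow_le X Y & diag [set a] \in unions Y].
have Pcoh Y : P Y -> coherent Y by case.
have Prb Y : P Y -> rainbow Y by move=> /Pcoh[].
split.
- exact: rainbow_cap_coherent.
- rewrite /rainbow_le (unions_rainbow_cap Prb); apply/subsetP => r Xr.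
  by apply/common_unionsP => Y [_ /subsetP XY _]; apply: XY.
- by rewrite (unions_rainbow_cap Prb); apply/common_unionsP => Y [].
move=> Y cY XY Ya; rewrite /rainbow_le (unions_rainbow_cap Prb).
by apply/subsetP => r /common_unionsP; apply.
Qed.

Lemma W_half_coherent X : coherent (W_half X).
Proof. by apply: rainbow_cap_coherent => Y [[]]. Qed.

End Adequacy.

(* Main.v *)
Require Import Defs.
From mathcomp Require Import all_boot all_algebra.
From mathcomp Require Import zify ring.

(** The incidence graph of a plane of order [n] is a bipartite graph in which
    two distinct vertices on the same side have a unique common neighbour and
    all degrees are [n + 1]; this notion does not distinguish points from lines.
    Its coherent closure is the distance scheme, with relations
    [dist x y = 0, 1, 2, 3].  Fixing a vertex [p] splits these relations
    according to the distances of [x] and [y] from [p], and splits once more the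
    pairs on level 2 according to whether they have a common neighbour adjacent
    to [p]; nothing else happens: the intersection numbers of this partition
    depend on [n] only.  So the distance scheme is sesquiclosed, hence equal to
    the W_{1/2}-closure, and matching relations with the same label gives the
    required algebraic isomorphism and all of its point extensions.

    To compute the intersection numbers, fix the level of the counted vertex
    [z]: the indicator of each label of [(x, z)] is then an integer combination
    of the four functions [1], [x == z], [adj x z], [collinear x z], and
    the inner products of such functions for [x] and for [y] are counted
    directly. *)

Import GRing.Theory Num.Theory.

Set Implicit Arguments.
Unset Strict Implicit.
Unset Printing Implicit Defensive.

(** * Coherent configurations given by a colouring of pairs *)

Lemma in_diag (T : finType) (D : {set T}) u :
  (u \in diag D) = (u.1 == u.2) && (u.1 \in D).
Proof.
apply/imsetP/andP => [[x Dx ->] /=|[/eqP E Du]]; first by rewrite eqxx.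
by exists u.1; rewrite // [LHS]surjective_pairing -E.
Qed.

Section Colourings.

Variables (T : finType) (I : eqType) (c : T * T -> I).
Implicit Types (u v : T * T) (r s : {set T * T}) (i j k : I).

Definition colour_class i : {set T * T} := [set u | c u == i].

(** Only attained colours are used, since a partition has no empty class. *)
Definition colour_classes : {set {set T * T}} :=
  [set colour_class (c u) | u in [set: T * T]].

Definition colour_count i j u : nat :=
  #|[set z | (c (u.1, z) == i) && (c (z, u.2) == j)]|.

Lemma colour_classesP s :
  reflect (exists u, s = colour_class (c u)) (s \in colour_classes).
Proof. by apply: (iffP imsetP) => [[u _ ->]|[u ->]]; exists u. Qed.

Lemma mem_colour_classes u : colour_class (c u) \in colour_classes.
Proof. by apply/colour_classesP; exists u. Qed.

Lemma colour_classes_partition : partition colour_classes [set: T * T].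
Proof.
apply/and3P; split.
- apply/eqP/setP => u; rewrite inE; apply/bigcupP.
  by exists (colour_class (c u)); rewrite ?mem_colour_classes ?inE.
- apply/trivIsetP => s t /colour_classesP[u ->] /colour_classesP[v ->].
  apply: contraR => /pred0Pn[w /=]; rewrite !inE => /andP[/eqP <- /eqP <-].
  exact: eqxx.
- apply/negP => /colour_classesP[u /setP/(_ u)].
  by rewrite !inE eqxx.
Qed.

Lemma unions_colourP r :
  reflect (forall u v, c u = c v -> u \in r -> v \in r)
          (r \in unions colour_classes).
Proof.
apply: (iffP (unionsP _ colour_classes_partition)) => H.
  by move=> u v cuv; apply: (H _ _ _ (mem_colour_classes u)); rewrite inE ?cuv.
move=> s u v /colour_classesP[w ->]; rewrite !inE => /eqP <- /eqP cvu.
exact: H.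
Qed.

Lemma unions_colour_pred (F : pred I) :
  [set u | F (c u)] \in unions colour_classes.
Proof. by apply/unions_colourP => u v; rewrite !inE => ->. Qed.

Lemma inter_num_class i j u :
  inter_num (colour_class i) (colour_class j) u = colour_count i j u.
Proof. by apply: eq_card => z; rewrite !inE. Qed.

End Colourings.

(* For [c' = c] this is coherence; in general it makes [transfer c c'] below an
   algebraic isomorphism. *)
Definition equicount (T T' : finType) (I : eqType)
    (c : T * T -> I) (c' : T' * T' -> I) : Prop :=
  forall u u', c u = c' u' ->
  forall i j, colour_count c i j u = colour_count c' i j u'.

(** The first condition makes the diagonal a union of classes, the second closes the set of classes
    under converse. *)
Definition rainbow_colouring (T : finType) (I : eqType) (c : T * T -> I) : Prop :=
  (forall x u, c (x, x) = c u -> u.1 = u.2) /\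
  (forall u v, c u = c v -> c (u.2, u.1) = c (v.2, v.1)).

Lemma colour_classes_coherent (T : finType) (I : eqType) (c : T * T -> I) :
  rainbow_colouring c -> equicount c c -> coherent (colour_classes c).
Proof.
move=> [cdiag cconv] ccount; split; last first.
  move=> r s t /colour_classesP[ur ->] /colour_classesP[us ->].
  move=> /colour_classesP[ut ->] u v; rewrite !inE => /eqP cu /eqP cv.
  by rewrite !inter_num_class; apply: ccount; rewrite cu cv.
split; first exact: colour_classes_partition.
  apply/unions_colourP => u [y z] + /imsetP[x _ ux]; rewrite ux.
  by move/cdiag => /= <-; apply: imset_f.
move=> s /colour_classesP[u ->]; apply/colour_classesP; exists (u.2, u.1).
apply/setP => v; rewrite !inE; apply/eqP/eqP => /cconv //=.
  by rewrite -surjective_pairing.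
by rewrite -surjective_pairing.
Qed.

(** * Algebraic isomorphisms obtained by matching colours *)

Definition transfer (T T' : finType) (I : eqType) (c : T * T -> I)
    (c' : T' * T' -> I) (r : {set T * T}) : {set T' * T'} :=
  [set u' | [exists u in r, c u == c' u']].

Section Transfer.

Variables (T T' : finType) (I : eqType) (c : T * T -> I) (c' : T' * T' -> I).

Lemma equicount_sym : equicount c c' -> equicount c' c.
Proof. by move=> H u' u /esym cu i j; rewrite (H u u'). Qed.

(** A count that is nonzero for [c] is nonzero for [c']: starting from [(x, x)], a partner [y'] is
    found for [y], then a partner [z'] for [z]. *)
Lemma equicount_realized x x' : equicount c c' -> c (x, x) = c' (x', x') ->
  forall u, exists u', c u = c' u'.
Proof.
move=> H cx [y z].
have ex u u' : c u = c' u' -> forall w,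
    exists w', c (u.1, w) = c' (u'.1, w') /\ c (w, u.2) = c' (w', u'.2).
  move=> /H cu w; have := cu (c (u.1, w)) (c (w, u.2)).
  rewrite /colour_count => /esym E.
  have : 0 < #|[set z' | (c' (u'.1, z') == c (u.1, w)) &&
                         (c' (z', u'.2) == c (w, u.2))]|.
    by rewrite E card_gt0; apply/set0Pn; exists w; rewrite !inE !eqxx.
  rewrite card_gt0 => /set0Pn[w']; rewrite !inE => /andP[/eqP <- /eqP <-].
  by exists w'.
have [y' [_ /= cyx]] := ex _ _ cx y.
have [z' [/= cyz _]] := ex _ _ cyx z.
by exists (y', z').
Qed.

Lemma transfer_pred (F : pred I) : (forall u', exists u, c' u' = c u) ->
  transfer c c' [set u | F (c u)] = [set u' | F (c' u')].
Proof.
move=> real; apply/setP => u'; rewrite !inE; apply/existsP/idP => [[u]|Fu'].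
  by rewrite inE => /andP[Fu /eqP <-].
by have [u cu] := real u'; exists u; rewrite inE -cu Fu' eqxx.
Qed.

(** [transfer] acts pair by pair, so it commutes with unions and is its own extension from [S]. *)
Lemma ext_unions_transfer S r : partition S [set: T * T] -> r \in unions S ->
  ext_unions S (transfer c c') r = transfer c c' r.
Proof.
move=> Spart Sr; apply/setP => u'; apply/bigcupP/idP => [[s /andP[_ /subsetP sr]]|].
  rewrite !inE => /existsP[u /andP[su cu]]; apply/existsP; exists u.
  by rewrite sr.
rewrite inE => /existsP[u /andP[ru cu]].
have : u \in cover S by case/and3P: Spart => /eqP ->; rewrite inE.
case/bigcupP => s Ss su; exists s; last first.
  by rewrite inE; apply/existsP; exists u; rewrite su.
rewrite Ss; apply/subsetP => v sv.
by move/(unionsP _ Spart): Sr => /(_ s u v Ss su sv ru).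
Qed.

End Transfer.

(** [equicount c c'] is preservation of intersection numbers; the common colour of [(x, x)] and
    [(x', x')] makes both colourings attain the same colours, so the classes correspond
    bijectively. *)
Lemma alg_iso_transfer (T T' : finType) (I : eqType) (c : T * T -> I)
    (c' : T' * T' -> I) x x' : rainbow_colouring c -> rainbow_colouring c' ->
  equicount c c -> equicount c' c' -> equicount c c' ->
  c (x, x) = c' (x', x') ->
  alg_iso (colour_classes c) (colour_classes c') (transfer c c').
Proof.
move=> rc rc' e e' ee' cx.
have real := equicount_realized ee' cx.
have real' := equicount_realized (equicount_sym ee') (esym cx).
have tr i : transfer c c' (colour_class c i) = colour_class c' i.
  exact: (transfer_pred (pred1 i) real').
split; try exact: colour_classes_coherent.
- move=> _ _ /colour_classesP[u ->] /colour_classesP[v ->]; rewrite !tr.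
  have [u' cu] := real u; move/setP/(_ u'); rewrite !inE cu eqxx.
  by move/esym/eqP => ->.
- apply/setP => s; apply/imsetP/colour_classesP => [[_ /colour_classesP[u ->] ->]|[u' ->]].
    by have [u' cu] := real u; exists u'; rewrite tr cu.
  by have [u cu] := real' u'; exists (colour_class c (c u));
    rewrite ?tr ?cu ?mem_colour_classes.
move=> _ _ _ /colour_classesP[ur ->] /colour_classesP[us ->] /colour_classesP[ut ->].
move=> u u'; rewrite !tr !inE !inter_num_class => /eqP cu /eqP cu'.
by apply: ee'; rewrite cu cu'.
Qed.

(** * Operations that preserve the unions of basis relations *)

Section Coherent.

Variables (T : finType) (Y : {set {set T * T}}).
Hypothesis Ycoh : coherent Y.
Implicit Types r s : {set T * T}.

Definition rel_comp r s : {set T * T} :=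
  [set u | [exists z, ((u.1, z) \in r) && ((z, u.2) \in s)]].

Let Ypart : partition Y [set: T * T].
Proof. by case: Ycoh => -[]. Qed.

Lemma coherent_unionsC r : r \in unions Y -> ~: r \in unions Y.
Proof.
move=> /(unionsP _ Ypart) Yr; apply/(unionsP _ Ypart) => s u v Ys su sv.
by rewrite !inE; apply: contra; apply: (Yr s).
Qed.

Lemma coherent_unionsI r s : r \in unions Y -> s \in unions Y ->
  r :&: s \in unions Y.
Proof.
move=> /(unionsP _ Ypart) Yr /(unionsP _ Ypart) Ys; apply/(unionsP _ Ypart).
move=> t u v Yt tu tv; rewrite !inE => /andP[ru su].
by rewrite (Yr t u v) ?(Ys t u v).
Qed.

Lemma coherent_unions_converse r : r \in unions Y -> converse r \in unions Y.
Proof.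
move=> /(unionsP _ Ypart) Yr; apply/(unionsP _ Ypart) => t u v Yt tu tv.
rewrite !inE; have [_ _ /(_ t Yt) Yt'] := Ycoh.1.
by apply: (Yr _ _ _ Yt'); rewrite inE -surjective_pairing.
Qed.

Lemma coherent_unionsT : [set: T * T] \in unions Y.
Proof. by apply/(unionsP _ Ypart) => *; rewrite inE. Qed.

(** A pair lies in the composite when its intersection number is positive, and that number is
    constant on basis relations. *)
Lemma coherent_unions_comp r s : r \in unions Y -> s \in unions Y ->
  rel_comp r s \in unions Y.
Proof.
move=> Yr Ys; apply/(unionsP _ Ypart) => t u v Yt tu tv.
have E w : (w \in rel_comp r s) = (0 < inter_num r s w).
  rewrite inE card_gt0; apply/existsP/set0Pn => -[z]; rewrite ?inE => H.
    by exists z; rewrite !inE.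
  by exists z.
by rewrite !E (coherent_unions Ycoh Yr Ys Yt tu tv).
Qed.

End Coherent.

Lemma partition_unions_inj (T : finType) (S S' : {set {set T * T}}) :
  partition S [set: T * T] -> partition S' [set: T * T] ->
  unions S = unions S' -> S = S'.
Proof.
wlog suff H : S S' / partition S [set: T * T] -> partition S' [set: T * T] ->
    unions S = unions S' -> S \subset S'.
  by move=> pS pS' U; apply/eqP; rewrite eqEsubset !H.
move=> pS pS' U; apply/subsetP => s Ss.
have /set0Pn[u su] : s != set0.
  by case/and3P: pS => _ _; apply: contraNneq => <-.
have : u \in cover S' by case/and3P: pS' => /eqP ->; rewrite inE.
case/bigcupP => s' S's' s'u; suff -> : s = s' by [].
have /(unionsP _ pS') H1 : s \in unions S' by rewrite -U sub_unions.
have /(unionsP _ pS) H2 : s' \in unions S by rewrite U sub_unions.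
apply/eqP; rewrite eqEsubset; apply/andP; split; apply/subsetP => v.
  by move=> sv; apply: (H2 s u v).
by move=> sv; apply: (H1 s' u v).
Qed.

(** A member of [Q] that lies below all members of [Q] is their intersection. This computes both the
    point extensions and the W_{1/2}-closure. *)
Lemma rainbow_cap_colour (T : finType) (I : eqType) (c : T * T -> I)
    (Q : {set {set T * T}} -> Prop) :
  (forall Y, Q Y -> rainbow Y) -> Q (colour_classes c) ->
  (forall Y i, Q Y -> colour_class c i \in unions Y) ->
  rainbow_cap Q = colour_classes c.
Proof.
move=> Qr Qc Qmin; apply: partition_unions_inj.
- exact: rainbow_cap_partition.
- exact: colour_classes_partition.
rewrite unions_rainbow_cap //; apply/setP => r.
apply/common_unionsP/idP => [/(_ _ Qc) //|rc Y QY].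
have [Ypart _ _] := Qr Y QY.
apply/(unionsP _ Ypart) => s u v Ys su sv; move/unions_colourP: rc; apply.
move/(unionsP _ Ypart): (Qmin Y (c u) QY) => /(_ s u v Ys su sv).
by rewrite !inE eqxx => /(_ isT)/eqP.
Qed.

(** * Distances from a base vertex *)

(** [common_nbr] states existence and uniqueness of the common neighbour in one equation. Both sides
    satisfy the same axioms, so a count from a base vertex covers points and lines alike. *)
Record trigon (n : nat) := Trigon {
  vert :> finType;
  adj : rel vert;
  side : vert -> bool;
  adjC : symmetric adj;
  adj_side : forall x y, adj x y -> side x != side y;
  common_nbr : forall x y, x != y -> side x = side y ->
    exists w, forall z, (adj x z && adj y z) = (z == w);
  sum_adj : forall x, \sum_z adj x z = n.+1
}.

Arguments adj {n t}.
Arguments side {n t}.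

Lemma sum_eq_andb (T : finType) (w : T) (F : pred T) :
  \sum_z ((z == w) && F z) = F w.
Proof.
rewrite (bigD1 w) //= eqxx big1 ?addn0 // => z /negPf ->.
by [].
Qed.

Section Distance.

Variables (n : nat) (V : trigon n).
Implicit Types x y z w : V.

(** The graph distance by cases: two vertices on the same side are equal or have a common neighbour,
    so no distance exceeds 3. *)
Definition dist x y : nat :=
  if x == y then 0 else if adj x y then 1 else if side x == side y then 2 else 3.

Lemma adjxx x : adj x x = false.
Proof. by apply/negP => /adj_side; rewrite eqxx. Qed.

Lemma distC x y : dist x y = dist y x.
Proof. by rewrite /dist [y == x]eq_sym adjC [side y == _]eq_sym. Qed.

Lemma dist_eq0 x y : (dist x y == 0) = (x == y).
Proof. by rewrite /dist; do !case: ifP. Qed.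

Lemma dist_eq1 x y : (dist x y == 1) = adj x y.
Proof.
by rewrite /dist; case: (eqVneq x y) => [->|_]; rewrite ?adjxx //; do !case: ifP.
Qed.

Lemma distxx x : dist x x = 0.
Proof. by rewrite /dist eqxx. Qed.

Lemma dist_le3 x y : dist x y <= 3.
Proof. by rewrite /dist; do !case: ifP. Qed.

Lemma odd_dist x y : odd (dist x y) = (side x != side y).
Proof.
rewrite /dist; case: (eqVneq x y) => [->|_]; first by rewrite eqxx.
by case: ifP => [/adj_side -> //|_]; case: ifP.
Qed.

Lemma odd_dist2 p x y : (side x != side y) = odd (dist p x) (+) odd (dist p y).
Proof. by rewrite !odd_dist; case: (side x); case: (side y); case: (side p). Qed.

Lemma dist_eq2 x y : (dist x y == 2) = (x != y) && (side x == side y).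
Proof.
rewrite /dist; case: (eqVneq x y) => //= _.
by case: ifP => [/adj_side/negPf ->|_] //; case: ifP.
Qed.

Lemma dist_eq2P x y :
  reflect (x != y /\ exists w, adj x w && adj w y) (dist x y == 2).
Proof.
rewrite dist_eq2; apply: (iffP andP) => -[xy].
  move/eqP => /(common_nbr xy)[w /(_ w)]; rewrite eqxx [adj y w]adjC.
  by split=> //; exists w.
case=> w /andP[/adj_side sxw /adj_side swy]; split=> //.
by move: sxw swy; case: (side x); case: (side y); case: (side w).
Qed.

(** The intersection array: the number of neighbours on level [l] of a vertex on level [k]. *)
Definition level_degree (k l : nat) : nat :=
  match k with
  | 0 => (l == 1) * n.+1
  | 1 => (l == 0) + (l == 2) * n
  | 2 => (l == 1) + (l == 3) * n
  | _ => (l == 2) * n.+1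
  end.

Definition level_size (l : nat) : nat :=
  match l with 0 => 1 | 1 => n.+1 | 2 => n * n.+1 | 3 => n * n | _ => 0 end.

Variable p : V.

(** Adjacent vertices have levels of different parity. From levels 0 and 3 all neighbours are on one
    level; from levels 1 and 2 exactly one is lower, namely [p] or the common neighbour with [p],
    and [n] are higher. *)
Lemma sum_adj_level x l :
  \sum_z ((dist p z == l) && adj x z) = level_degree (dist p x) l.
Proof.
have all k : (forall z, adj x z -> dist p z = k) ->
    \sum_z ((dist p z == l) && adj x z) = (l == k) * n.+1.
  move=> H; rewrite -(sum_adj x) big_distrr /=; apply: eq_bigr => z _.
  case: (boolP (adj x z)) => [/H ->|_]; last by rewrite andbF muln0.
  by rewrite andbT muln1 eq_sym.
have two k k' : k != k' ->
    (forall z, adj x z -> (dist p z == k) || (dist p z == k')) ->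
    \sum_z ((dist p z == k) && adj x z) = 1 ->
    \sum_z ((dist p z == l) && adj x z) = (l == k) + (l == k') * n.
  move=> kk' H E; have [->|lk] := eqVneq l k.
    by rewrite E (negPf kk').
  have [->|lk'] := eqVneq l k'; last first.
    rewrite big1 // => z _; case: eqP => [zl|] //=.
    case: (boolP (adj x z)) => // /H.
    by rewrite zl (negPf lk) (negPf lk').
  rewrite mul1n add0n; apply/eqP; rewrite -(eqn_add2l 1) -{1}E -big_split /=.
  rewrite add1n -(sum_adj x); apply/eqP; apply: eq_bigr => z _.
  case: (boolP (adj x z)) => [/H|]; last by rewrite !andbF.
  rewrite !andbT; case: eqP => [->|_]; first by rewrite (negPf kk').
  by move=> /= ->.
have par z : adj x z -> odd (dist p x) (+) odd (dist p z).
  by rewrite -odd_dist2 => /adj_side.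
have := dist_le3 p x; case E : (dist p x) => [|[|[|[]]]] //= _.
- apply: all => z; move/eqP: E; rewrite dist_eq0 => /eqP <-.
  by rewrite -dist_eq1 => /eqP.
- apply: two => // [z /par|].
    by have := dist_le3 p z; rewrite E; case: (dist p z) => [|[|[|[]]]].
  rewrite -[RHS](_ : nat_of_bool (adj x p) = _); last first.
    by rewrite adjC -dist_eq1 E.
  rewrite -(sum_eq_andb p (adj x)); apply: eq_bigr => z _.
  by rewrite dist_eq0 [p == z]eq_sym.
- apply: two => // [z /par|].
    by have := dist_le3 p z; rewrite E; case: (dist p z) => [|[|[|[]]]].
  have : dist p x == 2 by rewrite E.
  rewrite dist_eq2 => /andP[px /eqP /(common_nbr px)[w Hw]].
  rewrite -[RHS](_ : nat_of_bool (xpredT w) = _) // -(sum_eq_andb w xpredT).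
  by apply: eq_bigr => z _; rewrite andbT -Hw dist_eq1.
- apply: all => z xz; have := par z xz; rewrite E.
  have := dist_le3 p z; case E' : (dist p z) => [|[|[|[]]]] //= _ _.
  have /eqP pz : p == z by rewrite -dist_eq0 E'.
  by move: xz; rewrite adjC -pz -dist_eq1 E.
Qed.

Lemma sum_level l : \sum_z (dist p z == l) = level_size l.
Proof.
have S1 : \sum_z (dist p z == 1) = n.+1.
  by rewrite -(sum_adj p); apply: eq_bigr => z _; rewrite dist_eq1.
(* Double counting of the edges between levels [k] and [m]. *)
have count k m : \sum_z (dist p z == k) * level_degree k m =
    \sum_z (dist p z == m) * level_degree m k.
  transitivity (\sum_z \sum_w ((dist p z == k) * ((dist p w == m) && adj z w))).
    apply: eq_bigr => z _; rewrite -big_distrr /= sum_adj_level.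
    by case: eqP => [->|].
  rewrite exchange_big /=; apply: eq_bigr => w _.
  transitivity ((dist p w == m) * \sum_z ((dist p z == k) && adj w z)).
    rewrite big_distrr /=; apply: eq_bigr => z _; rewrite adjC.
    by do 2!case: (_ == _); case: (adj _ _).
  by rewrite sum_adj_level; case: eqP => [->|].
have S2 : \sum_z (dist p z == 2) = n * n.+1.
  have := count 2 1; rewrite -!big_distrl /= S1; lia.
have := dist_le3 p; case: l => [|[|[|[|l]]]] //= le3.
- rewrite -[RHS](_ : nat_of_bool (xpredT p) = _) // -(sum_eq_andb p xpredT).
  by apply: eq_bigr => z _; rewrite andbT dist_eq0 eq_sym.
- have := count 3 2; rewrite -!big_distrl /= S2; nia.
- by rewrite big1 // => z _; case: eqP (le3 z) => // ->.
Qed.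

(** An equivalence relation on level 2: having the same neighbour on level 1. For a point [p] this
    means lying on a common line through [p]. *)
Definition collinear x y : bool :=
  [&& dist p x == 2, dist p y == 2 & [exists w, [&& adj p w, adj w x & adj w y]]].

(* The distance, except that it is 4 for two distinct vertices of level 2 which
   are collinear with [p]. *)
Definition dist4 x y : nat :=
  if (dist x y == 2) && collinear x y then 4 else dist x y.

Lemma collinearC x y : collinear x y = collinear y x.
Proof.
rewrite /collinear andbCA; congr [&& _, _ & _].
by apply: eq_existsb => w; rewrite [adj w x && _]andbC.
Qed.

Lemma dist4C x y : dist4 x y = dist4 y x.
Proof. by rewrite /dist4 distC collinearC. Qed.

(** [m] is the common neighbour of [p] and [y]. Counts that involve collinearity with [y] thus
    become counts of neighbours of [m]. *)
Lemma collinear_nbr y : dist p y = 2 -> exists m,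
  [/\ dist p m = 1, forall w, dist p w = 1 -> adj w y = (w == m)
    & forall z, collinear y z = (dist p z == 2) && adj m z].
Proof.
move=> py; have : dist p y == 2 by rewrite py.
rewrite dist_eq2 => /andP[npy /eqP /(common_nbr npy)[m Hm]]; exists m.
have := Hm m; rewrite eqxx -dist_eq1 adjC => /andP[/eqP pm my]; split=> // [w /eqP|z].
  by rewrite dist_eq1 => pw; rewrite -Hm pw adjC.
rewrite /collinear py /=; congr andb; apply/existsP/idP => [[w /and3P[pw wy wz]]|mz].
  by have := Hm w; rewrite pw adjC wy => /esym/eqP <-.
by exists m; rewrite -dist_eq1 pm my.
Qed.

Lemma collinearxx x : collinear x x = (dist p x == 2).
Proof.
apply/idP/idP => [/and3P[] //|/eqP px].
by have [m [pm mx ->]] := collinear_nbr px; rewrite px mx ?eqxx.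
Qed.

Lemma dist4_le4 x y : dist4 x y <= 4.
Proof. by rewrite /dist4; case: ifP => // _; apply: leqW; apply: dist_le3. Qed.

Lemma dist4_eq0 x y : (dist4 x y == 0) = (x == y).
Proof. by rewrite -dist_eq0 /dist4; case: ifP => // /andP[/eqP ->]. Qed.

Lemma dist4_eq1 x y : (dist4 x y == 1) = adj x y.
Proof. by rewrite -dist_eq1 /dist4; case: ifP => // /andP[/eqP ->]. Qed.

Lemma dist_dist4 x y : dist x y = if dist4 x y == 4 then 2 else dist4 x y.
Proof.
rewrite /dist4; case: (boolP (_ && _)) => [/andP[/eqP ->] //|_].
by case: (eqVneq (dist x y) 4) (dist_le3 x y) => // ->.
Qed.

Lemma odd_dist4 x y : odd (dist4 x y) = odd (dist p x) (+) odd (dist p y).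
Proof.
by rewrite -odd_dist2 -odd_dist dist_dist4; case: (eqVneq (dist4 x y) 4) => [->|].
Qed.

(** Two vertices on level 2 are on the same side, so they are equal or at distance 2. *)
Lemma collinear_dist4 x y : collinear x y =
  [&& dist p x == 2, dist p y == 2 & dist4 x y \in [:: 0; 4]].
Proof.
case: (eqVneq (dist p x) 2) => [px|]; last by rewrite /collinear => /negPf ->.
case: (eqVneq (dist p y) 2) => [py|]; last first.
  by rewrite /collinear => /negPf ->; rewrite !andbF.
rewrite /= !inE dist4_eq0; case: (eqVneq x y) => [->|xy].
  by rewrite collinearxx py.
have : side x = side y.
  by apply/eqP; rewrite -[_ == _]negbK (odd_dist2 p) px py.
move/eqP => sxy; have /eqP d2 : dist x y == 2 by rewrite dist_eq2 xy.
by rewrite /dist4 d2 /=; case: collinear.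
Qed.

(* The common neighbours on level [l] of two vertices on levels [k] and [k']
   with [dist4] equal to [d]. *)
Definition common_count (l k k' d : nat) : nat :=
  if d == 0 then level_degree k l else if odd d then 0 else
  l == if odd k then (if (k == 1) && (k' == 1) then 0 else 2)
       else if [|| k == 0, k' == 0 | d == 4] then 1 else 3.

(** Distinct vertices on one side have a single common neighbour [w]. Its level is found from
    parity, from whether [w] is [p], and for two vertices on level 2 from collinearity. *)
Lemma sum_common l x y :
  \sum_z ((dist p z == l) && (adj x z && adj y z)) =
  common_count l (dist p x) (dist p y) (dist4 x y).
Proof.
rewrite /common_count dist4_eq0; case: (eqVneq x y) => [->|xy].
  by rewrite -sum_adj_level; apply: eq_bigr => z _; rewrite andbb.
have -> : odd (dist4 x y) = (side x != side y).
  by rewrite odd_dist4 -odd_dist2.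
case: eqVneq => [sxy|/eqP sxy] /=; last first.
  rewrite big1 // => z _; case: and3P => //= -[_ /adj_side xz /adj_side yz].
  by move: sxy xz yz; case: (side x); case: (side y); case: (side z).
have [w Hw] := common_nbr xy sxy.
have -> : \sum_z ((dist p z == l) && (adj x z && adj y z)) = (dist p w == l).
  rewrite -(sum_eq_andb w (fun z => dist p z == l)).
  by apply: eq_bigr => z _; rewrite Hw andbC.
rewrite eq_sym; congr (nat_of_bool (l == _)).
have /andP[xw yw] : adj x w && adj y w by rewrite Hw.
have parx : odd (dist p x) (+) odd (dist p w).
  by rewrite -odd_dist2; apply: adj_side.
have parxy : odd (dist p x) = odd (dist p y).
  by apply/eqP; rewrite -negb_add -odd_dist2 sxy eqxx.
have w0 : (dist p w == 0) = (dist p x == 1) && (dist p y == 1).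
  by rewrite dist_eq0 !dist_eq1 ![adj p _]adjC Hw.
have := dist_le3 p w; move: parx parxy w0.
have := dist_le3 p y; have := dist_le3 p x.
case px : (dist p x) => [|[|[|[]]]] //; case py : (dist p y) => [|[|[|[]]]] //=;
  move=> _ _ + _; case pw : (dist p w) => [|[|[|[]]]] //= _ _ _.
- by move/eqP: px xw pw; rewrite dist_eq0 => /eqP <-; rewrite -dist_eq1 => /eqP ->.
- by move/eqP: px xw pw; rewrite dist_eq0 => /eqP <-; rewrite -dist_eq1 => /eqP ->.
- by move/eqP: py yw pw; rewrite dist_eq0 => /eqP <-; rewrite -dist_eq1 => /eqP ->.
(* For [x] and [y] on level 2, [w] is on level 1 exactly when [collinear x y] holds. *)
all: have d2 : dist x y == 2 by rewrite dist_eq2 xy sxy eqxx.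
all: rewrite /dist4 d2 /collinear px py /=; case: existsP => [[v]|nex] /=.
- by [].
- case: nex; exists w; rewrite -dist_eq1 pw /=.
  by rewrite ![adj w _]adjC xw yw.
- move=> /and3P[pv vx vy]; have := Hw v; rewrite ![adj _ v]adjC vx vy => /esym/eqP vw.
  by move: pv; rewrite vw -dist_eq1 pw.
- by rewrite (eqP d2).
Qed.

(* The generators are coded by [a = 0, 1, 2, 3]; [generator_value a k k' d] is
   the value of the generator [a] on a pair of levels [k, k'] with [dist4]
   equal to [d]. *)
Definition generator (a : nat) (x z : V) : bool :=
  match a with
  | 0 => true
  | 1 => x == z
  | 2 => adj x z
  | _ => collinear x z
  end.

Definition generator_value (a k k' d : nat) : bool :=
  match a with
  | 0 => true
  | 1 => d == 0
  | 2 => d == 1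
  | _ => [&& k == 2, k' == 2 & d \in [:: 0; 4]]
  end.

Lemma generatorE a x z :
  generator a x z = generator_value a (dist p x) (dist p z) (dist4 x z).
Proof.
case: a => [|[|[|a]]] //=; first by rewrite dist4_eq0.
  by rewrite dist4_eq1.
exact: collinear_dist4.
Qed.

(* The number of [z] of level [l] at which the generators [a] of [x] and [b] of
   [y] are both true, where [x] and [y] have levels [k] and [k'] and [dist4]
   equal to [d]; [gram_upper] is meaningful for [a <= b] only. *)
Definition gram_upper (l a b k k' d : nat) : nat :=
  match a, b with
  | 0, 0 => level_size l
  | 0, 1 => k' == l
  | 0, 2 => level_degree k' l
  | 0, _ => ((l == 2) && (k' == 2)) * n
  | 1, _ => (k == l) && generator_value b k' k d
  | 2, 2 => common_count l k k' d
  | 2, _ => ((l == 2) && (k' == 2)) *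
            (if k == 1 then (d == 1) * n else (k == 3))
  | _, _ => [&& l == 2, k == 2, k' == 2 & d \in [:: 0; 4]] * n
  end.

(** The Gram matrix of the generators on level [l]. Exchanging [x] and [y] swaps [a] with [b] and
    [k] with [k'], but keeps [d] by [dist4C]. *)
Definition gram (l a b k k' d : nat) : nat :=
  if a <= b then gram_upper l a b k k' d else gram_upper l b a k' k d.

Lemma gramE l a b x y : a < 4 -> b < 4 ->
  \sum_z ((dist p z == l) && (generator a x z && generator b y z)) =
  gram l a b (dist p x) (dist p y) (dist4 x y).
Proof.
wlog ab : a b x y / a <= b => [H|] a4 b4.
  case: (leqP a b) => [/H -> //|ba].
  have := H b a y x (ltnW ba) b4 a4.
  rewrite dist4C /gram (ltnW ba) leqNgt ba /= => <-; apply: eq_bigr => z _.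
  by rewrite [generator a x z && _]andbC.
have coll (F : pred V) w m : dist p w = 2 ->
    (forall z, collinear w z = (dist p z == 2) && adj m z) ->
    \sum_z ((dist p z == l) && (F z && collinear w z)) =
    (l == 2) * \sum_z ((dist p z == 2) && (F z && adj m z)).
  move=> pw Hw; rewrite big_distrr; apply: eq_bigr => z _ /=; rewrite Hw.
  have [->|l2] := eqVneq l 2; first by rewrite mul1n; case: (_ == 2); rewrite /= ?andbF.
  by case: eqP => //= ->; rewrite (negPf l2) /= andbF.
have ncoll (F : pred V) w : dist p w != 2 ->
    \sum_z ((dist p z == l) && (F z && collinear w z)) = 0.
  by move=> /negPf pw; rewrite big1 // => z _; rewrite /collinear pw !andbF.
rewrite /gram ab.
case: a ab a4 => [|[|[|[|]]]] //; last first.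
- case: b b4 => [|[|[|[|]]]] // _ _ _ /=.
  case: (eqVneq (dist p y) 2) => [py|/ncoll ->]; last by rewrite !andbF.
  case: (eqVneq (dist p x) 2) => [px|px]; last first.
    by rewrite big1 ?andbF // => z _; rewrite /collinear (negPf px) andbF.
  have [my [pmy adjy Hmy]] := collinear_nbr py.
  have [mx [pmx _ Hmx]] := collinear_nbr px.
  rewrite (coll _ _ _ py Hmy).
  transitivity ((l == 2) * \sum_z ((dist p z == 2) && (adj mx z && adj my z))).
    by congr (_ * _); apply: eq_bigr => z _; rewrite Hmx; case: (_ == 2).
  (* Either [mx] and [my] are equal, with [n] neighbours on level 2, or their only common neighbour
     is [p]. *)
  rewrite sum_common pmx pmy; have [_|_] //= := eqVneq l 2; rewrite !mul1n.
  have := collinear_dist4 x y; rewrite px py /= => <-; rewrite Hmx py /=.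
  rewrite adjy // /common_count dist4_eq0 odd_dist4 pmx pmy.
  by case: eqP => //= _; rewrite add0n.
- case: b b4 => [|[|[|[|]]]] // _ _ _ /=; first exact: sum_common.
  case: (eqVneq (dist p y) 2) => [py|/ncoll ->]; last by rewrite andbF.
  have [m [pm adjy Hm]] := collinear_nbr py.
  rewrite (coll _ _ _ py Hm) sum_common andbT; congr (_ * _).
  (* On level 1, [x] is [m] or shares only [p] with it; on level 3, the one common neighbour of [x]
     and [m] is on level 2. *)
  rewrite /common_count dist4_eq0 dist4_eq1 odd_dist4 pm.
  case: (eqVneq (dist p x) 1) => [px|px].
    by rewrite px adjy //; case: eqP => //= _; rewrite mul1n add0n.
  have /negPf -> : x != m by apply: contraNneq px => ->; rewrite pm.
  by case: (dist p x) px (dist_le3 p x) => [|[|[|[|]]]].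
- move=> _ _ /=.
  transitivity (nat_of_bool ((dist p x == l) && generator b y x)).
    rewrite -(sum_eq_andb x (fun z => (dist p z == l) && generator b y z)).
    apply: eq_bigr => z _; rewrite [z == x]eq_sym.
    by case: (x == z); rewrite /= ?andbF.
  by rewrite generatorE dist4C.
- move=> _ _; case: b b4 => [|[|[|[|]]]] // _ /=.
  + by rewrite -sum_level; apply: eq_bigr => z _; rewrite andbT.
  + rewrite -(sum_eq_andb y (fun z => dist p z == l)).
    by apply: eq_bigr => z _; rewrite andbC eq_sym.
  + exact: sum_adj_level.
  + case: (eqVneq (dist p y) 2) => [py|/(ncoll xpredT) /= ->]; last by rewrite !andbF.
    have [my [pmy _ Hmy]] := collinear_nbr py.
    rewrite (coll xpredT _ _ py Hmy) /= sum_adj_level pmy /=.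
    by rewrite andbT add0n mul1n.
Qed.

(* The coefficients in the generators of the indicator of [dist4 x z = d], for
   [x] of level [k] and [z] of level [l]. *)
Definition indicator_coef (k l d a : nat) : int :=
  let b := (k == 2) && (l == 2) in
  nth 0%R (match d with
           | 0 => [:: 0; 1; 0; 0]%R
           | 1 => [:: 0; 0; 1; 0]%R
           | 2 => [:: (~~ odd (k + l))%:R; b%:R - 1; 0; -1]%R
           | 3 => [:: (odd (k + l))%:R; 0; -1; 0]%R
           | 4 => [:: 0; - b%:R; 0; 1]%R
           | _ => [::]
           end) a.

(** Levels and parity restrict [dist4], which leaves a finite check. [collinear x z] also holds for
    [x = z] on level 2, hence the corrections by [b]; for [d > 4] the default of [nth] gives 0. *)
Lemma dist4_eqE d x z : ((dist4 x z == d)%:R =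
  \sum_(a < 4) indicator_coef (dist p x) (dist p z) d a * (generator a x z)%:R)%R.
Proof.
rewrite !big_ord_recl big_ord0 !generatorE /indicator_coef /=.
have := odd_dist4 x z.
have d4 : dist4 x z == 4 -> (dist p x == 2) && (dist p z == 2).
  rewrite /dist4; case: (boolP (_ && _)) => [/and4P[_ -> ->] //|_ /eqP E].
  by have := dist_le3 x z; rewrite E.
have k0 : dist4 x z == 0 -> dist p x = dist p z.
  by rewrite dist4_eq0 => /eqP ->.
move: (dist4 x z) (dist4_le4 x z) d4 k0 => t le4 d4 k0.
have := dist_le3 p x; have := dist_le3 p z.
move: (dist p x) (dist p z) d4 k0 => k l.
case: k => [|[|[|[|]]]] //; case: l => [|[|[|[|]]]] //;
  case: t le4 => [|[|[|[|[|]]]]] //= _ d4 k0 _ _ _;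
  try by have := d4 isT; try by have := k0 isT.
all: by case: d => [|[|[|[|[|d]]]]].
Qed.

(** Bilinear expansion, in the integers because of the signs. The right-hand side depends on [x] and
    [y] only through their levels and [dist4]. *)
Lemma sum_dist4 l d d' x y :
  ((\sum_z ((dist p z == l) && ((dist4 x z == d) && (dist4 y z == d'))))%:R =
   \sum_(a < 4) \sum_(b < 4)
      indicator_coef (dist p x) l d a * indicator_coef (dist p y) l d' b *
      (gram l a b (dist p x) (dist p y) (dist4 x y))%:R)%R.
Proof.
transitivity (\sum_z \sum_(a < 4) \sum_(b < 4)
    indicator_coef (dist p x) l d a * indicator_coef (dist p y) l d' b *
    ((dist p z == l) && (generator a x z && generator b y z))%:R)%R.
  rewrite natr_sum; apply: eq_bigr => z _; case: eqP => [<-|_] /=; last first.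
    by rewrite big1 // => a _; rewrite big1 // => b _; rewrite mulr0.
  rewrite -mulnb natrM !dist4_eqE big_distrl /=; apply: eq_bigr => a _.
  rewrite big_distrr /=; apply: eq_bigr => b _.
  by rewrite -mulnb natrM; ring.
rewrite exchange_big /=; apply: eq_bigr => a _.
rewrite exchange_big /=; apply: eq_bigr => b _.
by rewrite -gramE // natr_sum -big_distrr.
Qed.

(** * Intersection numbers of the partition given by a base vertex *)

Definition point_colour (u : V * V) : nat * nat * nat :=
  (dist p u.1, dist p u.2, dist4 u.1 u.2).

(** The level of [z] occurs in both colours, hence [l' == l]; symmetry of [dist4] puts [z] second in
    both. *)
Lemma point_colour_count k l d l' k' d' u :
  colour_count point_colour (k, l, d) (l', k', d') u =
  [&& dist p u.1 == k, dist p u.2 == k' & l' == l] *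
  \sum_z ((dist p z == l) && ((dist4 u.1 z == d) && (dist4 u.2 z == d'))).
Proof.
rewrite /colour_count -sum1dep_card big_distrr /= big_mkcond /=.
apply: eq_bigr => z _; rewrite /point_colour /= !xpair_eqE [dist4 z _]dist4C.
case: (dist p u.1 == k); case: (dist p u.2 == k'); rewrite ?andbF //=.
have [->|ll'] := eqVneq l' l; last first.
  by have [->|] := eqVneq (dist p z) l; rewrite ?[l == l']eq_sym ?(negPf ll') /= ?andbF.
by rewrite !mul1n; do 3!case: (_ == _).
Qed.

End Distance.

(** The counts involve only [n] and the colour of the pair. Equal base vertices give coherence;
    different ones, even in different graphs, give algebraic isomorphisms. *)
Lemma equicount_point n (V V' : trigon n) (p : V) (p' : V') :
  equicount (point_colour p) (point_colour p').
Proof.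
move=> u u' [e1 e2 e3] [[k l] d] [[l' k'] d'].
rewrite !point_colour_count e1 e2; congr (_ * _).
by apply/eqP; rewrite -(eqr_nat int) !sum_dist4 e1 e2 e3.
Qed.

Lemma rainbow_point n (V : trigon n) (p : V) : rainbow_colouring (point_colour p).
Proof.
split=> [x u [_ _ E]|u v [e1 e2 e3]].
  by apply/eqP; rewrite -(dist4_eq0 p) -E dist4_eq0.
by rewrite /point_colour /= e1 e2 dist4C e3 dist4C.
Qed.

(** * The distance scheme and its point extensions *)

Definition dist_colour n (V : trigon n) (u : V * V) : nat := dist u.1 u.2.
Arguments dist_colour {n} V u.

Section DistanceColouring.

Variables (n : nat) (V : trigon n).
Implicit Types (x y z : V) (u : V * V).

Lemma rainbow_dist : rainbow_colouring (dist_colour V).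
Proof.
rewrite /dist_colour; split=> [x u /= E|u v E /=]; last by rewrite distC E distC.
by apply/eqP; rewrite -dist_eq0 -E distxx.
Qed.

Lemma dist4_base x y : dist4 x x y = dist x y.
Proof. by rewrite /dist4 /collinear distxx /= andbF. Qed.

(** Seen from [u.1], a pair [(u.1, z)] at distance [i] has colour [(0, i, i)]. Distance 2 splits
    into the [dist4] values 2 and 4, and 4 itself is not a distance. *)
Lemma dist_colour_count i j u :
  colour_count (dist_colour V) i j u =
  (j != 4) * colour_count (point_colour u.1) (0, i, i) (i, dist u.1 u.2, j) u +
  (j == 2) * colour_count (point_colour u.1) (0, i, i) (i, dist u.1 u.2, 4) u.
Proof.
rewrite /colour_count -!sum1dep_card !big_distrr /= big_mkcond /=.
rewrite [in RHS]big_mkcond [X in _ = _ + X]big_mkcond -big_split /=.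
apply: eq_bigr => z _; rewrite /point_colour /dist_colour /= distxx dist4_base.
rewrite !xpair_eqE eqxx andbb /=; case: eqP => //= _.
rewrite eqxx /= (dist_dist4 u.1 z u.2).
have := dist4_le4 u.1 z u.2.
by case: (dist4 u.1 z u.2) => [|[|[|[|[|]]]]] // _; case: j => [|[|[|[|[|j]]]]].
Qed.

End DistanceColouring.

Lemma equicount_dist n (V V' : trigon n) :
  equicount (dist_colour V) (dist_colour V').
Proof.
move=> u u' E i j; rewrite !dist_colour_count; move: E; rewrite /dist_colour => E.
have pE : point_colour u.1 u = point_colour u'.1 u'.
  by rewrite /point_colour !dist4_base !distxx E.
by rewrite E !(equicount_point pE).
Qed.

(** * Point extensions of the distance scheme *)

Section Extension.

Variables (n : nat) (V : trigon n).
Implicit Types (x y z p : V) (u : V * V).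

Lemma point_colour_dist p u v : point_colour p u = point_colour p v ->
  dist_colour V u = dist_colour V v.
Proof. by case=> _ _ E; rewrite /dist_colour (dist_dist4 p) E -dist_dist4. Qed.

Lemma point_colour_diag p u : (point_colour p u == (0, 0, 0)) = (u == (p, p)).
Proof.
rewrite /point_colour !xpair_eqE !dist_eq0 dist4_eq0 -pair_eqE /pair_eq /=.
rewrite ![p == _]eq_sym; case: eqP => //= ->; case: eqP => //= ->.
by rewrite eqxx.
Qed.

(** Each class is built from [diag [set p]] and the distance relations by composition, converse,
    intersection and complement. *)
Lemma point_colour_class_unions p Y i : coherent Y ->
  rainbow_le (colour_classes (dist_colour V)) Y ->
  diag [set p] \in unions Y -> colour_class (point_colour p) i \in unions Y.
Proof.
move=> Ycoh /subsetP leY Yp; case: i => [[k l] d].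
have YD (F : pred nat) : [set u : V * V | F (dist u.1 u.2)] \in unions Y.
  by apply: leY; apply: (unions_colour_pred (dist_colour V) F).
have Y1 m : [set u : V * V | dist p u.1 == m] \in unions Y.
  rewrite (_ : [set u | _] = rel_comp (rel_comp [set u | dist u.1 u.2 == m]
      (diag [set p])) [set: V * V]).
    by rewrite !coherent_unions_comp ?(YD (pred1 m)) ?coherent_unionsT.
  apply/setP => -[x y]; rewrite !inE /=; apply/eqP/existsP => [px|[z]].
    exists p; rewrite !inE andbT /=; apply/existsP; exists p.
    by rewrite in_diag !inE /= distC px !eqxx.
  rewrite !inE andbT => /existsP[w]; rewrite in_diag !inE /= => /andP[xw].
  by case/andP=> _ /eqP <-; rewrite distC; apply/eqP.
have Y2 m : [set u : V * V | dist p u.2 == m] \in unions Y.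
  rewrite (_ : [set u | _] = converse [set u | dist p u.1 == m]).
    exact: coherent_unions_converse.
  by apply/setP => u; rewrite !inE.
have YE : [set u : V * V | adj u.1 u.2] \in unions Y.
  rewrite (_ : [set u | _] = [set u | dist u.1 u.2 == 1]) ?(YD (pred1 1)) //.
  by apply/setP => u; rewrite !inE dist_eq1.
(* Collinearity is a path of two edges through level 1. *)
have YC : [set u : V * V | collinear p u.1 u.2] \in unions Y.
  rewrite (_ : [set u | _] = ([set u | dist p u.1 == 2] :&:
    [set u | dist p u.2 == 2]) :&: rel_comp ([set u | dist p u.2 == 1] :&:
      [set u | adj u.1 u.2]) [set u | adj u.1 u.2]).
    by rewrite !(coherent_unionsI, coherent_unions_comp).
  apply/setP => u; rewrite !inE /= -andbA; congr [&& _, _ & _].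
  by apply: eq_existsb => w; rewrite !inE /= dist_eq1 [adj w u.1]adjC andbA.
have Yd : [set u : V * V | dist4 p u.1 u.2 == d] \in unions Y.
  have [d4|d4] := eqVneq d 4.
    rewrite (_ : [set u | _] = [set u | dist u.1 u.2 == 2] :&:
        [set u | collinear p u.1 u.2]).
      by rewrite coherent_unionsI ?(YD (pred1 2)).
    apply/setP => u; rewrite !inE d4 /dist4; case: (boolP (_ && _)) => // _.
    by have := dist_le3 u.1 u.2; case: (eqVneq (dist u.1 u.2) 4) => // ->.
  have [d2|d2] := eqVneq d 2.
    rewrite (_ : [set u | _] = [set u | dist u.1 u.2 == 2] :&:
        ~: [set u | collinear p u.1 u.2]).
      by rewrite coherent_unionsI ?coherent_unionsC ?(YD (pred1 2)).
    apply/setP => u; rewrite !inE d2 /dist4.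
    by case: (eqVneq (dist u.1 u.2) 2) => [->|/negPf //]; case: collinear.
  rewrite (_ : [set u | _] = [set u | dist u.1 u.2 == d]) ?(YD (pred1 d)) //.
  apply/setP => u; rewrite !inE (dist_dist4 p).
  have [->|//] := eqVneq (dist4 p u.1 u.2) 4.
  by rewrite ![_ == d]eq_sym (negPf d4) (negPf d2).
rewrite (_ : colour_class _ _ = ([set u | dist p u.1 == k] :&:
    [set u | dist p u.2 == l]) :&: [set u | dist4 p u.1 u.2 == d]).
  by rewrite !coherent_unionsI.
by apply/setP => u; rewrite !inE /= !xpair_eqE.
Qed.

Lemma point_ext_dist p :
  point_ext (colour_classes (dist_colour V)) p = colour_classes (point_colour p).
Proof.
apply: rainbow_cap_colour => [Y [[]]//||Y i []]; last exact: point_colour_class_unions.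
split.
- apply: colour_classes_coherent; [exact: rainbow_point|exact: equicount_point].
- apply/subsetP => r /unions_colourP rU; apply/unions_colourP => u v.
  by move/point_colour_dist; apply: rU.
rewrite (_ : diag _ = [set u | point_colour p u == (0, 0, 0)]).
  exact: (unions_colour_pred (point_colour p) (pred1 (0, 0, 0))).
apply/setP => u; rewrite inE point_colour_diag in_diag inE.
rewrite -pair_eqE /pair_eq /= eq_sym andbC.
by case: eqP => //= ->.
Qed.

(** This is condition (S1). The colour of [(x, x)] records just the level of [x], so the fibers are
    the nonempty levels. *)
Lemma fibers_point_ext p :
  fibers (point_ext (colour_classes (dist_colour V)) p) =
  [set out_nbrs p s | s in colour_classes (dist_colour V) & out_nbrs p s != set0].
Proof.
have diagE x : diag [set z | dist p z == dist p x] =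
    colour_class (point_colour p) (point_colour p (x, x)).
  apply/setP => u; rewrite in_diag !inE /point_colour /= !xpair_eqE.
  rewrite /dist4 distxx /= -/(dist4 p u.1 u.2) dist4_eq0.
  by case: eqP => [->|]; rewrite ?andbF ?andbT ?andbb.
have nbrE x : out_nbrs p (colour_class (dist_colour V) (dist_colour V (p, x))) =
    [set z | dist p z == dist p x].
  by apply/setP => z; rewrite !inE.
rewrite point_ext_dist; apply/setP => D; rewrite inE.
apply/colour_classesP/imsetP => [[u Du]|[s]].
  have : u \in diag D by rewrite Du inE.
  rewrite in_diag => /andP[/eqP uE Dx].
  exists (colour_class (dist_colour V) (dist_colour V (p, u.1))).
    rewrite inE mem_colour_classes nbrE; apply/set0Pn; exists u.1.
    by rewrite inE.
  rewrite nbrE; apply/setP => z.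
  have := congr1 (fun r : {set V * V} => (z, z) \in r) Du.
  rewrite (_ : u = (u.1, u.1)) -?diagE; last by rewrite {2}uE -surjective_pairing.
  by rewrite !in_diag eqxx /=.
rewrite inE => /andP[/colour_classesP[u ->]] /set0Pn[x]; rewrite !inE.
move=> /eqP <- ->; exists (x, x).
by rewrite nbrE diagE.
Qed.

End Extension.

(** * Sesquiclosure, the closure of the graph and the equivalence *)

Section Equivalence.

Variables (n : nat).

Lemma dist_realized (V V' : trigon n) (x : V) (x' : V') :
  forall u, exists u', dist_colour V u = dist_colour V' u'.
Proof.
apply: (@equicount_realized _ _ _ _ _ x x'); first exact: equicount_dist.
by rewrite /dist_colour !distxx.
Qed.

(** With [phi] the identity this gives (S2); with [phi] the matching of distances between two graphs
    it gives the extensions of the required isomorphism. *)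
Lemma has_point_extension_dist (V V' : trigon n) (x : V) (x' : V') phi :
  (forall i, phi (colour_class (dist_colour V) i) = colour_class (dist_colour V') i) ->
  has_point_extension (colour_classes (dist_colour V))
    (colour_classes (dist_colour V')) phi x x'.
Proof.
move=> phiE; have e00 : point_colour x (x, x) = point_colour x' (x', x').
  by rewrite /point_colour !dist4_base !distxx.
have e' := equicount_sym (@equicount_point n V V' x x').
have real' := equicount_realized e' (esym e00).
exists (transfer (point_colour x) (point_colour x')); rewrite !point_ext_dist.
have ext := ext_unions_transfer (point_colour x) (point_colour x')
  (colour_classes_partition (point_colour x)).
split.
- apply: (alg_iso_transfer _ _ _ _ _ e00);
    do [exact: rainbow_point|exact: equicount_point].
- move=> s /colour_classesP[u ->]; rewrite phiE.
  (* [F] forgets the base vertex: the value 4 of [dist4] is distance 2. *)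
  pose F (i : nat * nat * nat) := (if i.2 == 4 then 2 else i.2) == dist_colour V u.
  have FE (W : trigon n) (w : W) : colour_class (dist_colour W) (dist_colour V u) =
      [set v | F (point_colour w v)].
    by apply/setP => v; rewrite !inE /F /= -dist_dist4.
  by rewrite (FE V x) (FE V' x') ext ?unions_colour_pred // transfer_pred.
have DE (W : trigon n) (w : W) :
    diag [set w] = [set v | pred1 (0, 0, 0) (point_colour w v)].
  apply/setP => v; rewrite inE /= point_colour_diag in_diag inE.
  rewrite -pair_eqE /pair_eq /= eq_sym andbC.
  by case: eqP => //= ->.
by rewrite !DE ext ?unions_colour_pred // transfer_pred.
Qed.

Lemma sesquiclosed_dist (V : trigon n) : sesquiclosed (colour_classes (dist_colour V)).
Proof.
split.
- apply: colour_classes_coherent; [exact: rainbow_dist|exact: equicount_dist].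
- exact: fibers_point_ext.
by move=> D _ a a' _ _; apply: has_point_extension_dist.
Qed.

Lemma diag_dist (V : trigon n) :
  diag [set: V] = [set u | pred1 0 (dist_colour V u)].
Proof. by apply/setP => u; rewrite in_diag !inE /= andbT dist_eq0. Qed.

Lemma edge_dist (V : trigon n) :
  edge_set (@adj n V) = [set u | pred1 1 (dist_colour V u)].
Proof. by apply/setP => u; rewrite !inE /= dist_eq1. Qed.

Lemma nonedge_dist (V : trigon n) :
  nonedge_set (@adj n V) = [set u | predC (pred2 0 1) (dist_colour V u)].
Proof. by apply/setP => u; rewrite !inE /= negb_or dist_eq1 dist_eq0. Qed.

(** Off the diagonal, distance 2 is the composite of adjacency with itself, and distance 3 is what
    remains. So every admissible [Y] refines the distance scheme, which is itself sesquiclosed. *)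
Lemma W_half_trigon (V : trigon n) :
  W_half (graph_rainbow (@adj n V)) = colour_classes (dist_colour V).
Proof.
apply: rainbow_cap_colour => [Y [[[]]]//||Y i [[Ycoh _ _] /subsetP leY]].
  split; first exact: sesquiclosed_dist.
  apply/subsetP => r /imsetP[A]; rewrite powersetE => /subsetP sA ->.
  apply/unions_colourP => u v cuv /bigcupP[s As su]; apply/bigcupP; exists s => //.
  have : s \in unions (colour_classes (dist_colour V)).
    have := sA s As; rewrite !inE => /andP[_ /orP[/orP[]|] /eqP ->].
    - by rewrite diag_dist unions_colour_pred.
    - by rewrite edge_dist unions_colour_pred.
    - by rewrite nonedge_dist unions_colour_pred.
  by move/unions_colourP/(_ u v cuv su).
have Y0 : diag [set: V] \in unions Y by case: Ycoh => -[].
have YE : edge_set (@adj n V) \in unions Y.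
  (* An empty edge set is not a basis relation, but it is the empty union. *)
  apply: leY; have [->|E0] := eqVneq (edge_set (@adj n V)) set0.
    by apply/imsetP; exists set0; rewrite ?powersetE ?sub0set // /cover big_set0.
  by apply: sub_unions; rewrite !inE E0 eqxx orbT.
have Y2 : [set u : V * V | dist u.1 u.2 == 2] \in unions Y.
  rewrite (_ : [set u | _] = ~: diag [set: V] :&:
      rel_comp (edge_set (@adj n V)) (edge_set (@adj n V))).
    by rewrite coherent_unionsI ?coherent_unionsC ?coherent_unions_comp.
  apply/setP => u; rewrite in_setI in_setC in_diag !inE andbT.
  apply/dist_eq2P/andP => [[-> [w H]]|[-> /existsP[w H]]]; split=> //.
    by apply/existsP; exists w; rewrite !inE.
  by exists w; move: H; rewrite !inE.
rewrite /colour_class; case: i => [|[|[|i]]].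
- by have := diag_dist V => /= <-.
- by have := edge_dist V => /= <-.
- exact: Y2.
case: i => [|i].
  rewrite (_ : [set u | _] = ~: diag [set: V] :&: ~: edge_set (@adj n V) :&:
      ~: [set u : V * V | dist u.1 u.2 == 2]).
    by rewrite !(coherent_unionsI, coherent_unionsC).
  rewrite diag_dist edge_dist; apply/setP => u; rewrite !inE /= /dist_colour.
  by have := dist_le3 u.1 u.2; case: (dist u.1 u.2) => [|[|[|[|]]]].
(* Numbers above 3 are not distances, so their classes are empty. *)
rewrite (_ : [set u | _] = ~: [set: V * V]) ?coherent_unionsC ?coherent_unionsT //.
apply/setP => u; rewrite !inE /= /dist_colour.
by have := dist_le3 u.1 u.2; case: (dist u.1 u.2) => [|[|[|[|]]]].
Qed.

Lemma W_half_equiv_trigon (V V' : trigon n) (x : V) (x' : V') :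
  W_half_equiv (@adj n V) (@adj n V').
Proof.
rewrite /W_half_equiv /= !W_half_trigon.
have real' := dist_realized x' x.
have ext := ext_unions_transfer (dist_colour V) (dist_colour V')
  (colour_classes_partition (dist_colour V)).
exists (transfer (dist_colour V) (dist_colour V')); split; last first.
- by rewrite nonedge_dist ext ?unions_colour_pred // nonedge_dist transfer_pred.
- by rewrite edge_dist ext ?unions_colour_pred // edge_dist transfer_pred.
- by rewrite diag_dist ext ?unions_colour_pred // diag_dist transfer_pred.
split.
  apply: (@alg_iso_transfer _ _ _ _ _ x x');
    do [exact: rainbow_dist|exact: equicount_dist|idtac].
  by rewrite /dist_colour !distxx.
move=> D D' _ _ _ a a' _ _; apply: has_point_extension_dist => i.
by apply: (transfer_pred (pred1 i)).
Qed.

End Equivalence.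

(** * Projective planes *)

Section Plane.

Variables (P : projective_plane) (n : nat).
Hypothesis Pn : has_order P n.

(** If all lines passed through [p], the lines joining [q1] to [q2] and to [q3] would both be the
    line through [q1] and [p], which would then contain three points of the quadrangle. *)
Lemma line_avoiding (p : point P) : exists l : line P, ~~ incident p l.
Proof.
have [Q [Q4 Q2]] := plane_quadrangle P.
have /card_gt2P[q1 [q2 [q3 [[]]]]] : 2 < #|Q :\ p|.
  by rewrite -(ltn_add2l (p \in Q)) -cardsD1 Q4; case: (p \in Q).
rewrite !inE => /andP[q1p Q1] /andP[_ Q2'] /andP[_ Q3] [n12 n23 n31].
case: (pickP (fun l => ~~ incident p l)) => [l pl|pall]; first by exists l.
have thru l : incident p l by apply: negbFE; apply: pall.
have [l [[q1l q2l] _]] := plane_join n12; have [k [[q3k q1k] _]] := plane_join n31.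
have [m [_ mU]] := plane_join q1p.
have lk : l = k by rewrite -(mU l) ?(mU k).
suff : 2 < #|[set q in Q | incident q l]| by rewrite ltnNge Q2.
apply/card_gt2P; exists q1, q2, q3; split=> //.
by rewrite !inE Q1 Q2' Q3 q1l q2l lk q3k.
Qed.

(** Projection from [p] matches the lines through [p] with the points of a line [m] avoiding [p]. It
    is carried out by counting the pairs [(l, q)] with [p] and [q] on [l] and [q] on [m]. *)
Lemma sum_lines (p : point P) : \sum_(l : line P) incident p l = n.+1.
Proof.
have [m pm] := line_avoiding p.
have join q : p != q -> \sum_(l : line P) (incident p l && incident q l) = 1.
  move=> /plane_join[l [[pl ql] lU]].
  rewrite -[RHS](_ : nat_of_bool (xpredT l) = _) // -(sum_eq_andb l xpredT).
  apply: eq_bigr => k _; rewrite andbT; congr nat_of_bool.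
  apply/andP/eqP => [H|->//]; exact/esym/lU.
have meet l : l != m -> \sum_(q : point P) (incident q l && incident q m) = 1.
  move=> /plane_meet[q [[ql qm] qU]].
  rewrite -[RHS](_ : nat_of_bool (xpredT q) = _) // -(sum_eq_andb q xpredT).
  apply: eq_bigr => k _; rewrite andbT; congr nat_of_bool.
  apply/andP/eqP => [H|->//]; exact/esym/qU.
have <- : \sum_(q : point P) incident q m = n.+1.
  rewrite -(Pn m) -sum1dep_card [RHS]big_mkcond; apply: eq_bigr => q _.
  by case: (incident q m).
transitivity (\sum_(l : line P) \sum_(q : point P)
    (incident p l * (incident q l && incident q m))).
  apply: eq_bigr => l _; rewrite -big_distrr /=.
  case: (boolP (incident p l)) => // pl; rewrite meet //.
  by apply: contraNneq pm => <-.
rewrite exchange_big /=; apply: eq_bigr => q _.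
transitivity (incident q m * \sum_(l : line P) (incident p l && incident q l)).
  rewrite big_distrr; apply: eq_bigr => l _ /=.
  by do 3!case: (incident _ _).
case: (boolP (incident q m)) => // qm; rewrite join //.
by apply: contraNneq pm => ->.
Qed.

Definition plane_side (x : point P + line P) : bool :=
  if x is inl _ then true else false.

Lemma plane_adjC : symmetric (@incidence_graph P).
Proof. by move=> [p|l] [q|m]. Qed.

Lemma plane_adj_side x y : incidence_graph x y -> plane_side x != plane_side y.
Proof. by case: x y => [p|l] [q|m]. Qed.

Lemma plane_common x y : x != y -> plane_side x = plane_side y ->
  exists w : point P + line P,
  forall z, (incidence_graph x z && incidence_graph y z) = (z == w).
Proof.
case: x y => [p|l] [q|m] //= xy _.
  have /plane_join[l [[pl ql] lU]] : p != q by [].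
  exists (inr l) => -[r|k] //=.
  by apply/andP/eqP => [/lU ->|[->]].
have /plane_meet[q [[ql qm] qU]] : l != m by [].
exists (inl q) => -[k|r] //=.
by apply/andP/eqP => [/qU ->|[->]].
Qed.

Lemma plane_sum_adj x : \sum_(z : point P + line P) incidence_graph x z = n.+1.
Proof.
rewrite big_sumType /=; case: x => [p|l] /=.
  by rewrite big1 // sum_lines.
rewrite [X in _ + X]big1 // addn0 -(Pn l) -sum1dep_card [RHS]big_mkcond.
by apply: eq_bigr => q _; case: (incident q l).
Qed.

Definition plane_trigon : trigon n :=
  Trigon plane_adjC plane_adj_side plane_common plane_sum_adj.

End Plane.

Lemma point_inhabited (P : projective_plane) : inhabited (point P).
Proof.
have [Q [Q4 _]] := plane_quadrangle P.
by have /set0Pn[p _] : Q != set0; rewrite -?card_gt0 ?Q4.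
Qed.

Theorem theorem1p4 (P P' : projective_plane) (n : nat) :
  has_order P n -> has_order P' n ->
  W_half_equiv (@incidence_graph P) (@incidence_graph P').
Proof.
move=> Pn P'n; have [p] := point_inhabited P; have [p'] := point_inhabited P'.
exact: (@W_half_equiv_trigon n (plane_trigon Pn) (plane_trigon P'n) (inl p) (inl p')).
Qed.
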